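(* Let $\mathbb{B}$ be a complete Boolean algebra. Then: (a) If $\mathbb{B}$ satisfies condition $(\hbar)$, then $\lim_{\mathcal{O}_{\mathrm{lsi}}}=\lim_{\mathcal{O}_{\lambda_{\mathrm{s}}}}$. (b) If $\mathbb{B}$ is $(\omega,2)$-distributive, then $\lim_{\mathcal{O}_{\lambda_{\mathrm{ls}}}}=\lambda_{\mathrm{ls}}$, $\lim_{\mathcal{O}_{\lambda_{\mathrm{li}}}}=\lambda_{\mathrm{li}}$ and $\lim_{\mathcal{O}_{\mathrm{lsi}}}=\lim_{\mathcal{O}_{\lambda_{\mathrm{s}}}}=\lambda_{\mathrm{s}}$; so the convergences $\lambda_{\mathrm{s}},\lambda_{\mathrm{ls}},\lambda_{\mathrm{li}},\lambda_{\mathrm{s}}^*,\lambda_{\mathrm{ls}}^*,\lambda_{\mathrm{li}}^*,\lim_{\mathcal{O}_{\lambda_{\mathrm{s}}}},\lim_{\mathcal{O}_{\lambda_{\mathrm{ls}}}},\lim_{\mathcal{O}_{\lambda_{\mathrm{li}}}},\lim_{\mathcal{O}_{\mathrm{lsi}}}$ collapse to the three convergences $\lambda_{\mathrm{s}}=\lambda_{\mathrm{s}}^*=\lim_{\mathcal{O}_{\lambda_{\mathrm{s}}}}=\lim_{\mathcal{O}_{\mathrm{lsi}}}$, $\ \lambda_{\mathrm{ls}}=\lambda_{\mathrm{ls}}^*=\lim_{\mathcal{O}_{\lambda_{\mathrm{ls}}}}$ and $\ \lambda_{\mathrm{li}}=\lambda_{\mathrm{li}}^*=\lim_{\mathcal{O}_{\lambda_{\mathrm{li}}}}$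 (which are pairwise distinct if $\mathbb{B}$ is non-trivial, i.e. $0\neq1$). (c) If $\lim_{\mathcal{O}_{\mathrm{lsi}}}=\lim_{\mathcal{O}_{\lambda_{\mathrm{s}}}}$, then $\mathcal{O}_{\mathrm{lsi}}=\mathcal{O}_{\lambda_{\mathrm{s}}}$ if and only if $\langle\mathbb{B},\mathcal{O}_{\mathrm{lsi}}\rangle$ is a sequential space.
   Context: A convergence on a non-empty set $X$ is a map $\lambda:X^\omega\to P(X)$. For convergences, $\lambda_1\leq\lambda_2$ means $\lambda_1(x)\subseteq\lambda_2(x)$ for all $x\in X^\omega$. For a topology $\mathcal{O}$ on $X$, $\lim_{\mathcal{O}}$ is the convergence for which $\lim_{\mathcal{O}}(x)$ is the set of all $a\in X$ such that each neighborhood of $a$ contains all but finitely many members of the sequence $x$. For each convergence $\lambda$, $\mathcal{O}_\lambda$ denotes the (unique) maximal topology $\mathcal{O}$ on $X$ with $\lambda\leq\lim_{\mathcal{O}}$. Further, $\lambda^*$ is defined by $\lambda^*(x)=\bigcap_{f}\bigcup_{g}\lambda(x\circ f\circ g)$, where $f,g$ range over all strictly increasing functions $\omega\to\omega$. A topological space $\langle X,\mathcal{O}\rangle$ is sequential iff each set $A\subseteq X$ is closed exactly when it is sequentially closed, i.e. $\lim_{\mathcal{O}}(x)\subseteq A$ for each $x\in A^\omega$. On a complete Boolean algebra $\mathbb{B}$, for $x=\langle x_n:n\in\omega\rangle\in\mathbb{B}^\omega$ let $\liminf x=\bigvee_{k\in\omega}\bigwedge_{n\geq k}x_n$ and $\limsup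 x=\bigwedge_{k\in\omega}\bigvee_{n\geq k}x_n$, and define convergences on $\mathbb{B}$ by $\lambda_{\mathrm{ls}}(x)=\{b\in\mathbb{B}: b\geq\limsup x\}$, $\lambda_{\mathrm{li}}(x)=\{b\in\mathbb{B}: b\leq\liminf x\}$, and $\lambda_{\mathrm{s}}(x)=\{a\}$ if $\liminf x=\limsup x=a$, while $\lambda_{\mathrm{s}}(x)=\emptyset$ if $\liminf x<\limsup x$. The topology $\mathcal{O}_{\mathrm{lsi}}$ is the minimal topology on $\mathbb{B}$ containing $\mathcal{O}_{\lambda_{\mathrm{ls}}}\cup\mathcal{O}_{\lambda_{\mathrm{li}}}$. For sequences, $y\prec x$ means that $y$ is a subsequence of $x$, i.e. $y=x\circ f$ for some strictly increasing $f:\omega\to\omega$. Condition $(\hbar)$ on $\mathbb{B}$: for every $x\in\mathbb{B}^\omega$ there is $y\prec x$ such that for every $z\prec y$ we have $\limsup z=\limsup y$. $\mathbb{B}$ is $(\omega,2)$-distributive iff for every sequence $\langle a_n:n\in\omega\rangle$ in $\mathbb{B}$ we have $\bigvee_{f:\omega\to\{0,1\}}\bigwedge_{n\in\omega}a_n^{f(n)}=1$, where $a^1=a$ and $a^0=a'$ is the complement of $a$. *)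

(* Defs.v *)
From mathcomp Require Import all_boot all_order.
From mathcomp Require Import boolp classical_sets functions cardinality.

Set Implicit Arguments.
Unset Strict Implicit.
Unset Printing Implicit Defensive.

Import Order.TTheory.

Local Open Scope classical_set_scope.

Section Convergences.
Variable X : Type.

Implicit Types (O : set (set X)) (x y : nat -> X) (A U V : set X).

Definition convergence := (nat -> X) -> set X.

Definition conv_le (l1 l2 : convergence) := forall x, l1 x `<=` l2 x.

(* Topologies are sets of open sets, so that several topologies on the same
   carrier can be compared. *)
Definition is_topology O :=
  [/\ O setT,
      forall U V, O U -> O V -> O (U `&` V)
    & forall F : set (set X), F `<=` O -> O (\bigcup_(U in F) U)].

Definition neighborhoods O (a : X) : set (set X) :=
  [set V | exists2 U, O U & U a /\ U `<=` V].

Definition lim_of O : convergence := fun x =>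
  [set a | forall V, neighborhoods O a V -> cofinite_set [set n | V (x n)]].

Definition maximal_topology (l : convergence) O :=
  [/\ is_topology O, conv_le l (lim_of O)
    & forall O', is_topology O' -> conv_le l (lim_of O') ->
        O `<=` O' -> O' = O].

(* [maximal_topology_of] and [maximal_topology_unique] below show that the
   default value of [get] is never used and that the choice is forced. *)
Definition topology_of (l : convergence) : set (set X) :=
  get (maximal_topology l).

Definition strictly_increasing (f : nat -> nat) :=
  {homo f : m n / (m < n)%N}.

Definition subsequence y x :=
  exists2 f, strictly_increasing f & y = x \o f.

Definition conv_star (l : convergence) : convergence := fun x =>
  \bigcap_(f in strictly_increasing)
    \bigcup_(g in strictly_increasing) l (x \o f \o g).

Definition closed_in O A := O (~` A).

Definition sequentially_closed O A :=
  forall x, (forall n, A (x n)) -> lim_of O x `<=` A.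

Definition sequential_space O :=
  forall A, closed_in O A <-> sequentially_closed O A.

Lemma lim_of_open O x a :
  lim_of O x a <-> forall U, O U -> U a -> cofinite_set [set n | U (x n)].
Proof.
split=> [h U OU Ua|h V [U OU [Ua UV]]]; last first.
  by apply: sub_finite_set (h U OU Ua) => n /= nV Un; apply: nV; exact: UV.
by apply: h; exists U => //; split=> // b.
Qed.

Lemma exists_greatest_topology (l : convergence) :
  exists O, [/\ is_topology O, conv_le l (lim_of O)
    & forall O', is_topology O' -> conv_le l (lim_of O') -> O' `<=` O].
Proof.
pose O := [set U | forall x a, l x a -> U a -> cofinite_set [set n | U (x n)]].
exists O; split.
- split=> [x a _ _|U V OU OV x a lxa [Ua Va]|F FO x a lxa [U FU Ua]].
  + by apply: sub_finite_set (finite_set0 nat) => n /= nT; exact: nT.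
  + have := OV _ _ lxa Va; have := OU _ _ lxa Ua => fU fV.
    have fUV : finite_set (~` [set n | U (x n)] `|` ~` [set n | V (x n)]).
      by rewrite finite_setU.
    apply: sub_finite_set fUV => n /=.
    by rewrite -[_ \/ _]/(~ U (x n) \/ ~ V (x n)) => /not_andP.
  + apply: sub_finite_set (FO U FU x a lxa Ua) => n /= nF Un.
    by apply: nF; exists U.
- by move=> x a lxa; apply/lim_of_open => U /(_ x a lxa).
- by move=> O' _ lO' U O'U x a /lO' /lim_of_open /(_ U O'U).
Qed.

Lemma maximal_topology_of (l : convergence) :
  maximal_topology l (topology_of l).
Proof.
have [O [tO lO gO]] := exists_greatest_topology l.
apply: (@getPex _ (maximal_topology l)); exists O; split=> // O' tO' lO' OO'.
by apply/seteqP; split=> //; exact: gO.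
Qed.

Lemma maximal_topology_unique (l : convergence) O1 O2 :
  maximal_topology l O1 -> maximal_topology l O2 -> O1 = O2.
Proof.
have [O [tO lO gO]] := exists_greatest_topology l.
move=> [t1 l1 m1] [t2 l2 m2].
have e1 : O = O1 by apply: m1 => //; exact: gO.
have e2 : O = O2 by apply: m2 => //; exact: gO.
by rewrite -e1.
Qed.

Lemma is_topology_smallest (S : set (set X)) :
  is_topology (smallest is_topology S).
Proof.
split=> [O [[OT _ _] _] //|U V SU SV O [tO SO]|F FS O [tO SO]].
- by have [_ OI _] := tO; apply: OI; [exact: SU|exact: SV].
- by have [_ _ OU] := tO; apply: OU => U /FS; apply.
Qed.

End Convergences.

(* Completeness is a hypothesis on a Boolean algebra; when it fails, the
   operations below take default values. *)
Definition complete d (B : porderType d) :=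
  forall A : set B, supremums A !=set0 /\ infimums A !=set0.

Section CompleteBooleanAlgebra.
Context {d : Order.disp_t} {B : ctbDistrLatticeType d}.

Implicit Types (x y z a : nat -> B) (A : set B).

(* The default values are the supremum and the infimum of the empty set. *)
Definition bsup A : B := supremum \bot%O A.
Definition binf A : B := infimum \top%O A.

Definition liminf x : B :=
  bsup (range (fun k => binf [set x n | n in [set n | (k <= n)%N]])).

Definition limsup x : B :=
  binf (range (fun k => bsup [set x n | n in [set n | (k <= n)%N]])).

Definition lambda_ls : convergence B := fun x => [set b | (limsup x <= b)%O].
Definition lambda_li : convergence B := fun x => [set b | (b <= liminf x)%O].
Definition lambda_s : convergence B := fun x =>
  [set b | liminf x = b /\ limsup x = b].

Definition O_ls : set (set B) := topology_of lambda_ls.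
Definition O_li : set (set B) := topology_of lambda_li.
Definition O_s : set (set B) := topology_of lambda_s.
Definition O_lsi : set (set B) := smallest (@is_topology B) (O_ls `|` O_li).

End CompleteBooleanAlgebra.

Arguments lambda_ls {d} B.
Arguments lambda_li {d} B.
Arguments lambda_s {d} B.
Arguments O_ls {d} B.
Arguments O_li {d} B.
Arguments O_s {d} B.
Arguments O_lsi {d} B.

Definition hbar_condition d (B : ctbDistrLatticeType d) :=
  forall x : nat -> B, exists2 y, subsequence y x &
    forall z, subsequence z y -> limsup z = limsup y.

Definition omega_two_distributive d (B : ctbDistrLatticeType d) :=
  forall a : nat -> B,
    bsup (range (fun f : nat -> bool =>
      binf (range (fun n => if f n then a n else (~` a n)%O)))) = \top%O.

(* Main.v *)
Require Import Defs.
From mathcomp Require Import all_boot all_order.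
From mathcomp Require Import boolp classical_sets functions cardinality.

(** A set is closed for [O_ls] as soon as it is upward closed and closed under
limsups of sequences. Separating a limit [a] of [x] from [x] by such sets gives
[limsup x <= a] when the algebra is distributive, and [limsup y <= a] along
some subsequence [y] of each subsequence of [x] under (hbar); complementation
transfers both facts to [O_li]. Limits for [O_lsi] are the common limits for
[O_ls] and [O_li], and [lambda_s] is the meet of [lambda_ls] and [lambda_li],
so every limit for [O_lsi] is one for [lambda_s] or for its star, hence for
[O_s]. The last part holds because [O_s] is sequential and finer than
[O_lsi], and a sequential topology is determined by its limits. *)

Set Implicit Arguments.
Unset Strict Implicit.
Unset Printing Implicit Defensive.

Import Order.Theory.

Local Open Scope classical_set_scope.
Local Open Scope order_scope.

(** * Cofinite sets of indices and subsequences *)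

Lemma cofinite_natP (P : set nat) :
  cofinite_set P <-> exists N, forall n, (N <= n)%N -> P n.
Proof.
split=> [/finite_seqP[s sE]|[N NP]]; last first.
  apply: sub_finite_set (finite_II N) => n /= nP.
  by rewrite ltnNge; apply/negP => /NP.
exists (\max_(i <- s) i).+1%N => n ltn; apply: contrapT => nP.
have ns : n \in s by have : [set` s] n by rewrite -sE.
by move: ltn; rewrite ltnNge (leq_bigmax_seq _ ns).
Qed.

Lemma frequent_subsequence (P : set nat) :
  (forall N, exists2 n, (N <= n)%N & P n) ->
  exists2 f, strictly_increasing f & forall n, P (f n).
Proof.
move=> PN; have /choice[g gP] : forall N, exists n, (N <= n)%N /\ P n.
  by move=> N; have [n] := PN N; exists n.
(* Applying [g] after [S] moves strictly beyond the current index. *)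
pose f n := iter n (g \o S) (g 0%N).
exists f => [|[|n]]; [|exact: (gP _).2|exact: (gP _).2].
by apply: homo_ltn ltn_trans _ => n; exact: (gP _).1.
Qed.

Lemma not_cofinite_subsequence (P : set nat) : ~ cofinite_set P ->
  exists2 f, strictly_increasing f & forall n, ~ P (f n).
Proof.
move=> nP; apply: (@frequent_subsequence (~` P)) => N; apply: contrapT => nN.
apply: nP; apply/cofinite_natP; exists N => n Nn; apply: contrapT => nPn.
by apply: nN; exists n.
Qed.

Lemma strictly_increasing_ge f : strictly_increasing f ->
  forall n, (n <= f n)%N.
Proof.
move=> fI; elim=> // n /leq_ltn_trans; apply.
exact: fI.
Qed.

Lemma strictly_increasing_comp f g : strictly_increasing f ->
  strictly_increasing g -> strictly_increasing (f \o g).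
Proof. by move=> fI gI m n mn; apply: fI; exact: gI. Qed.

Lemma cofinite_comp (P : set nat) f : strictly_increasing f ->
  cofinite_set P -> cofinite_set (P \o f).
Proof.
move=> fI /cofinite_natP[N NP]; apply/cofinite_natP; exists N => n Nn.
exact/NP/(leq_trans Nn)/strictly_increasing_ge.
Qed.

(** * Limits, maximal topologies and sequential spaces *)

(** This lets convergence in a generated topology be tested on the generators alone. *)
Lemma is_topology_convergent (X : Type) (x : nat -> X) (a : X) :
  is_topology [set U : set X | U a -> cofinite_set [set n | U (x n)]].
Proof.
split=> [_|U V Ux Vx [/Ux Uc /Vx Vc]|F Fx [U FU Ua]].
- by apply/cofinite_natP; exists 0%N.
- move: Uc Vc => /cofinite_natP[M Mx] /cofinite_natP[N Nx].
  apply/cofinite_natP; exists (maxn M N) => n; rewrite geq_max => /andP[Mn Nn].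
  by split; [exact: Mx|exact: Nx].
- have /cofinite_natP[N Nx] := Fx U FU Ua.
  by apply/cofinite_natP; exists N => n Nn; exists U => //; exact: Nx.
Qed.

Lemma lim_of_smallest (X : Type) (S : set (set X)) x a :
  lim_of (smallest (@is_topology X) S) x a <->
  forall U, S U -> U a -> cofinite_set [set n | U (x n)].
Proof.
split=> [/lim_of_open xa U SU|xa]; last apply/lim_of_open => U SU.
  by apply: xa; exact: sub_gen_smallest.
exact: (SU _ (conj (is_topology_convergent x a) xa)).
Qed.

(** The maximal topology is the greatest one, so it contains the topology generated by any single
    [U] that meets the condition. *)
Lemma topology_ofP (X : Type) (l : convergence X) U :
  topology_of l U <->
  forall x a, l x a -> U a -> cofinite_set [set n | U (x n)].
Proof.
have [tl lel ml] := maximal_topology_of l; split=> [lU x a /lel|lU].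
  by move=> /lim_of_open; exact.
have [O [tO lO gO]] := exists_greatest_topology l.
rewrite -(ml O tO lO (gO _ tl lel)).
apply: (gO (smallest (@is_topology X) [set U])); last exact: sub_gen_smallest.
  exact: is_topology_smallest.
by move=> x a lxa; apply/lim_of_smallest => V ->; exact: lU lxa.
Qed.

Lemma lim_of_comp (X : Type) (O : set (set X)) x f a :
  strictly_increasing f -> lim_of O x a -> lim_of O (x \o f) a.
Proof. by move=> fI xa V /xa; exact: cofinite_comp. Qed.

Lemma lim_of_anti (X : Type) (O1 O2 : set (set X)) : O1 `<=` O2 ->
  conv_le (lim_of O2) (lim_of O1).
Proof.
by move=> O12 x a /lim_of_open xa; apply/lim_of_open => U /O12; exact: xa.
Qed.

Lemma topology_of_anti (X : Type) (l1 l2 : convergence X) : conv_le l1 l2 ->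
  topology_of l2 `<=` topology_of l1.
Proof.
move=> l12 U /topology_ofP lU; apply/topology_ofP => x a /l12; exact: lU.
Qed.

Lemma conv_le_lim (X : Type) (l : convergence X) :
  conv_le l (lim_of (topology_of l)).
Proof. by have [] := maximal_topology_of l. Qed.

Definition hereditary (X : Type) (l : convergence X) :=
  forall f, strictly_increasing f -> forall x, l x `<=` l (x \o f).

Lemma conv_le_star (X : Type) (l : convergence X) : hereditary l ->
  conv_le l (conv_star l).
Proof. by move=> lh x a lxa f fI; exists id => //; exact: (lh f). Qed.

(** If a subsequence avoided an open set around [a], a further subsequence would converge to [a] for
    [l] and still avoid it. *)
Lemma conv_star_le_lim (X : Type) (l : convergence X) :
  conv_le (conv_star l) (lim_of (topology_of l)).
Proof.
move=> x a xa; apply/lim_of_open => U /topology_ofP lU Ua.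
apply: contrapT => /not_cofinite_subsequence[f fI fU].
have [g gI /lU /(_ Ua) /cofinite_natP[N NU]] := xa f fI.
exact: (fU _ (NU N (leqnn N))).
Qed.

Lemma conv_star_eq (X : Type) (l : convergence X) : hereditary l ->
  lim_of (topology_of l) = l -> conv_star l = l.
Proof.
move=> lh ll; apply/funext => x; apply/seteqP; split.
  by rewrite -[in X in _ `<=` X]ll; exact: conv_star_le_lim.
exact: conv_le_star.
Qed.

Lemma sequential_topology_of (X : Type) (l : convergence X) : hereditary l ->
  sequential_space (topology_of l).
Proof.
move=> lh A; split=> [cA x Ax a /lim_of_open xa|sA].
  apply: contrapT => /(xa _ cA) /cofinite_natP[N NA].
  exact: NA (leqnn N) (Ax N).
apply/topology_ofP => x a lxa nAa.
apply: contrapT => /not_cofinite_subsequence[f fI fA].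
apply: nAa; apply: (sA (x \o f)) => [n|].
  exact: contrapT (fA n).
exact: (@conv_le_lim _ l _ _ (lh f fI x a lxa)).
Qed.

Lemma sequential_eq (X : Type) (O1 O2 : set (set X)) : O1 `<=` O2 ->
  lim_of O1 = lim_of O2 -> sequential_space O2 ->
  O1 = O2 <-> sequential_space O1.
Proof.
move=> O12 l12 s2; split=> [->//|s1]; apply/seteqP; split=> // U.
rewrite -[U]setCK => /s2; rewrite /sequentially_closed -l12.
by move/s1.
Qed.

(** Preimages under [c] of open sets for [l1] are open for [l2]. With complementation as [c],
    results on limsups carry over to liminfs. *)
Lemma lim_of_conjugate (X : Type) (l1 l2 : convergence X) (c : X -> X) :
  involutive c -> (forall x a, l2 x a <-> l1 (c \o x) (c a)) ->
  forall x a, lim_of (topology_of l2) x a ->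
              lim_of (topology_of l1) (c \o x) (c a).
Proof.
move=> cK l21 x a /lim_of_open xa; apply/lim_of_open => U /topology_ofP lU.
apply: (xa (c @^-1` U)); apply/topology_ofP => y b /l21; exact: lU.
Qed.

(** * Limsup and liminf in a complete Boolean algebra *)

Section LimsupLiminf.
Context {d : Order.disp_t} {B : ctbDistrLatticeType d} (cB : complete B).
Implicit Types (x y z : nat -> B) (a b c p q : B) (A : set B).

Lemma bsupP A : supremums A (bsup A).
Proof.
have [->|A0] := eqVneq A set0; last first.
  by rewrite /bsup /supremum (negPf A0); exact: xgetPex (cB A).1.
by rewrite /bsup supremum0; split=> // b _; exact: le0x.
Qed.

Lemma binfP A : infimums A (binf A).
Proof.
have [->|A0] := eqVneq A set0; last first.
  by rewrite /binf /infimum (negPf A0); exact: xgetPex (cB A).2.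
by rewrite /binf /infimum eqxx; split=> // b _; exact: lex1.
Qed.

Lemma bsup_ub A a : A a -> a <= bsup A.
Proof. exact: (bsupP A).1. Qed.

Lemma binf_lb A a : A a -> binf A <= a.
Proof. exact: (binfP A).1. Qed.

Lemma bsup_le A b : (forall a, A a -> a <= b) -> bsup A <= b.
Proof. exact: (bsupP A).2. Qed.

Lemma binf_ge A b : (forall a, A a -> b <= a) -> b <= binf A.
Proof. exact: (binfP A).2. Qed.

Lemma bsup_compl A : bsup [set ~` a | a in A] = ~` binf A.
Proof.
apply/le_anti/andP; split.
  by apply: bsup_le => _ [a Aa <-]; rewrite leC; exact: binf_lb.
rewrite leCx; apply: binf_ge => a Aa; rewrite leCx.
by apply: bsup_ub; exists a.
Qed.

Lemma binf_compl A : binf [set ~` a | a in A] = ~` bsup A.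
Proof.
apply/le_anti/andP; split; last first.
  by apply: binf_ge => _ [a Aa <-]; rewrite leC; exact: bsup_ub.
rewrite lexC; apply: bsup_le => a Aa; rewrite lexC.
by apply: binf_lb; exists a.
Qed.

Lemma limsup_compl x : limsup (Order.compl \o x) = ~` liminf x.
Proof.
rewrite /limsup /liminf -binf_compl image_comp; congr (binf (image _ _)).
by apply/funext => k; rewrite /= -bsup_compl image_comp.
Qed.

(** With [le_limsup], this reduces estimates of limsups to upper bounds of tails. *)
Lemma limsup_le k x b : (forall n, (k <= n)%N -> x n <= b) -> limsup x <= b.
Proof.
move=> xb; apply: le_trans (bsup_le (A := x @` [set n | (k <= n)%N]) _).
  by apply: binf_lb; exists k.
by move=> _ [n kn <-]; exact: xb.
Qed.

Lemma le_limsup x c :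
  (forall k b, (forall n, (k <= n)%N -> x n <= b) -> c <= b) -> c <= limsup x.
Proof.
move=> xc; apply: binf_ge => _ [k _ <-]; apply: (xc k) => n kn.
by apply: bsup_ub; exists n.
Qed.

Lemma limsup_comp x f : strictly_increasing f -> limsup (x \o f) <= limsup x.
Proof.
move=> fI; apply: le_limsup => k b xb; apply: (@limsup_le k) => n kn.
exact/xb/(leq_trans kn)/strictly_increasing_ge.
Qed.

Lemma liminf_le_limsup x : liminf x <= limsup x.
Proof.
apply: le_limsup => k b xb; apply: bsup_le => _ [j _ <-].
apply: le_trans (xb (maxn j k) (leq_maxr _ _)).
by apply: binf_lb; exists (maxn j k) => //=; exact: leq_maxl.
Qed.

(** Every tail contains a term above [c], so each upper bound of a tail is above [c]. *)
Lemma limsup_frequent x c :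
  ~ cofinite_set [set n | ~ (c <= x n)] -> c <= limsup x.
Proof.
move=> nc; apply: le_limsup => k b xb; apply: contrapT => ncb; apply: nc.
apply/cofinite_natP; exists k => n kn cx.
exact/ncb/(le_trans cx)/xb.
Qed.

Lemma limsup_cst c : limsup (fun=> c) = c.
Proof.
apply/le_anti/andP; split; first exact: (@limsup_le 0).
by apply: le_limsup => k b /(_ k (leqnn k)).
Qed.

Lemma lambda_li_compl x a :
  lambda_li B x a <-> lambda_ls B (Order.compl \o x) (~` a).
Proof. by rewrite /lambda_ls /= limsup_compl leC. Qed.

Lemma lambda_sE x a : lambda_s B x a <-> lambda_ls B x a /\ lambda_li B x a.
Proof.
rewrite /lambda_s /lambda_ls /lambda_li /=.
split=> [[xa xb]|[xa ax]]; first by rewrite xa xb.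
have := liminf_le_limsup x => ii.
split; apply/le_anti/andP; split=> //; first exact: le_trans xa.
exact: le_trans ii.
Qed.

Lemma hereditary_ls : hereditary (lambda_ls B).
Proof. by move=> f fI x a; apply: le_trans; exact: limsup_comp. Qed.

Lemma hereditary_li : hereditary (lambda_li B).
Proof.
move=> f fI x a /lambda_li_compl xa; apply/lambda_li_compl.
exact: (hereditary_ls fI xa).
Qed.

Lemma hereditary_s : hereditary (lambda_s B).
Proof.
move=> f fI x a /lambda_sE[xa ax]; apply/lambda_sE.
split; first exact: (hereditary_ls fI xa).
exact: (hereditary_li fI ax).
Qed.

(** * Limits for [O_ls], [O_li] and [O_lsi], in general and under (hbar) *)

Lemma lim_li_compl x a :
  lim_of (O_li B) x a -> lim_of (O_ls B) (Order.compl \o x) (~` a).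
Proof. by apply: lim_of_conjugate lambda_li_compl _ _; exact: complK. Qed.

Lemma lim_lsiP x a :
  lim_of (O_lsi B) x a <-> lim_of (O_ls B) x a /\ lim_of (O_li B) x a.
Proof.
split=> [/lim_of_smallest xa|[/lim_of_open xa /lim_of_open ax]].
  by split; apply/lim_of_open => U OU; apply: xa; [left|right].
by apply/lim_of_smallest => U [/xa|/ax].
Qed.

Lemma O_lsi_sub : O_lsi B `<=` O_s B.
Proof.
have [tO _ _] := maximal_topology_of (lambda_s B).
apply: smallest_sub => //; rewrite subUset; split; apply: topology_of_anti.
  by move=> x a /lambda_sE[].
by move=> x a /lambda_sE[].
Qed.

(** If [z] met [C] infinitely often, the limsup of a subsequence in [C] would lie in [C] and below
    every [b] above [limsup z], forcing [b] into [C]. *)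
Lemma O_ls_setC (C : set B) : (forall a b, a <= b -> C a -> C b) ->
  (forall z, (forall n, C (z n)) -> C (limsup z)) -> O_ls B (~` C)%classic.
Proof.
move=> upC limC; apply/topology_ofP => z b zb nCb.
apply: contrapT => /not_cofinite_subsequence[f fI fC]; apply: nCb.
apply: upC (limC (z \o f) _) => [|n]; last exact: contrapT (fC n).
exact: le_trans (limsup_comp z fI) zb.
Qed.

(* If [y] has the same limsup [c] as all its subsequences and [c <= a] fails,
   the set of upper bounds of [c] or of a term of [y] outside of the ideal
   below [a] separates [y] from [a]. *)
Lemma hbar_lim_ls :
  hbar_condition B -> conv_le (lim_of (O_ls B)) (conv_star (lambda_ls B)).
Proof.
move=> hbar x a xa f fI; have [_ [g gI ->] ystable] := hbar (x \o f).
exists g => //; set y := (x \o f) \o g in ystable *.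
have ya : lim_of (O_ls B) y a.
  exact: lim_of_comp gI (lim_of_comp fI xa).
have ystab h : strictly_increasing h -> limsup (y \o h) = limsup y.
  by move=> hI; apply: ystable; exists h.
apply: contrapT => nya.
(* Otherwise a subsequence bounded by [a] would have limsup at most [a], and its limsup is that of
   [y]. Starting [C] at this [N] keeps [a] out of it. *)
have /cofinite_natP[N yN] : cofinite_set [set n | ~ (y n <= a)].
  apply: contrapT => /not_cofinite_subsequence[h hI ha]; apply: nya.
  rewrite /lambda_ls /= -/y -(ystab h hI); apply: (@limsup_le 0) => n _.
  exact: contrapT (ha n).
pose C := [set b | (exists2 n, (N <= n)%N & y n <= b) \/ limsup y <= b].
have OC : O_ls B (~` C)%classic.
  apply: O_ls_setC => [b c bc [[n Nn yb]|yb]|z Cz].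
  - by left; exists n => //; exact: le_trans bc.
  - by right; exact: le_trans bc.
  (* Assuming [limsup z] outside [C], every upper bound [b] of a tail of [z] turns out to be above
     [limsup y], which puts [limsup z] in [C] after all. *)
  apply: contrapT => nC; apply: (nC); right; apply: le_limsup => k b zb.
  have /cofinite_natP[K cK] : cofinite_set [set n | ~ (limsup y <= z n)].
    by apply: contrapT => nc; apply: nC; right; exact: limsup_frequent nc.
  have yz m : (N <= m)%N -> exists K, forall k, (K <= k)%N -> ~ (y m <= z k).
    move=> Nm; apply/(cofinite_natP [set k | ~ (y m <= z k)]).
    apply: contrapT => nc; apply: nC.
    by left; exists m => //; exact: limsup_frequent nc.
  (* Each [y m] with [N <= m] is eventually not below [z k]; this makes the threshold uniform over
     the finitely many [m < M]. *)
  have yzM M : exists K, forall k, (K <= k)%N ->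
      forall m, (N <= m < M)%N -> ~ (y m <= z k).
    elim: M => [|M [L IH]]; first by exists 0%N => ? _ m; rewrite ltn0 andbF.
    have [NM|MN] := leqP N M; last first.
      exists 0%N => ? _ m /andP[Nm]; rewrite ltnS => /(leq_trans Nm).
      by rewrite leqNgt MN.
    have [L' IH'] := yz M NM.
    exists (maxn L L') => j; rewrite geq_max => /andP[Lj L'j] m.
    rewrite ltnS (leq_eqVlt m) => /andP[Nm /predU1P[->|mM]]; first exact: IH'.
    by apply: IH => //; rewrite Nm.
  have [h hI hb] : exists2 h, strictly_increasing h & forall n, y (h n) <= b.
    apply: frequent_subsequence (fun m => y m <= b) _ => M.
    (* Beyond [k], [z j] is below [b]; beyond [K], it is not above [limsup y]; beyond [L], it is
       above no [y m] with [N <= m < M]. So [z j] in [C] must be above some [y m] with [M <= m]. *)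
    have [L LM] := yzM M; pose j := maxn k (maxn K L).
    have kj : (k <= j)%N by exact: leq_maxl.
    have Kj : (K <= j)%N by rewrite !leq_max leqnn orbT.
    have Lj : (L <= j)%N by rewrite !leq_max leqnn !orbT.
    have [[m Nm ym]|yj] := Cz j; last by case: (cK j Kj).
    exists m; last exact: le_trans ym (zb j kj).
    by rewrite leqNgt; apply/negP => mM; apply: (LM j Lj m); rewrite ?Nm.
  by rewrite -(ystab h hI); apply: (@limsup_le 0) => n _; exact: hb.
have nCa : (~` C)%classic a by case=> // -[n Nn]; exact: yN.
have /cofinite_natP[M yM] := (lim_of_open _ _ _).1 ya _ OC nCa.
apply: (yM (maxn M N) (leq_maxl _ _)); left.
by exists (maxn M N) => //; exact: leq_maxr.
Qed.

Lemma hbar_lim_li :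
  hbar_condition B -> conv_le (lim_of (O_li B)) (conv_star (lambda_li B)).
Proof.
move=> hbar x a /lim_li_compl/(hbar_lim_ls hbar) xa f fI.
by have [g gI ga] := xa f fI; exists g => //; exact/lambda_li_compl.
Qed.

Lemma hbar_lim_lsi :
  hbar_condition B -> conv_le (lim_of (O_lsi B)) (conv_star (lambda_s B)).
Proof.
move=> hbar x a /lim_lsiP[/(hbar_lim_ls hbar) xa /(hbar_lim_li hbar) ax] f fI.
have [g gI ga] := xa f fI.
(* The second extraction is made inside the first, so that one subsequence serves both
   convergences. *)
have [h hI ha] := ax _ (strictly_increasing_comp fI gI).
exists (g \o h); first exact: strictly_increasing_comp.
by apply/lambda_sE; split=> //; exact: (hereditary_ls hI ga).
Qed.

(** * Limits under (omega,2)-distributivity *)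

(** If no choice [f] had a nonzero part in common with [p], the join of all the meets, which is
    [\top], would be below the complement of [p]. *)
Lemma omega_two_distributive_dec x p :
  omega_two_distributive B -> p != \bot ->
  exists f : nat -> bool, exists q,
    [/\ q != \bot, q <= p & forall n, q <= if f n then x n else ~` x n].
Proof.
move=> dB p0; apply: contrapT => np; move: p0; apply/negP; rewrite negbK.
suff : \top <= ~` p by rewrite lexC compl1 lex0.
rewrite -(dB x); apply: bsup_le => _ [f _ <-].
set q := binf _; rewrite -disj_leC; apply/negP => /negP qp.
apply: np; exists f, (q `&` p)%O; split => //; first exact: leIr.
by move=> n; apply: le_trans (leIl _ _) _; apply: binf_lb; exists n.
Qed.

(* A nonzero [q] below [limsup x - a] deciding all the terms of [x] lies below
   infinitely many of them, and the filter above [q] avoids [a]. *)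
Lemma distributive_lim_ls :
  omega_two_distributive B -> lim_of (O_ls B) = lambda_ls B.
Proof.
move=> dB; apply/funext => x; apply/seteqP; split; last exact: conv_le_lim.
move=> a /lim_of_open xa; apply: contrapT => nxa.
have : (limsup x `&` ~` a)%O != \bot by rewrite disj_leC complK; apply/negP.
move=> /(omega_two_distributive_dec x dB)[f [q [q0]]].
rewrite lexI => /andP[qx qa] fq.
have absurd b : q <= b -> q <= ~` b -> False.
  move=> qb qb'; apply/negP: q0; rewrite negbK -lex0 -(meetxC b).
  by rewrite lexI qb.
pose C := [set b | q <= b].
have OC : O_ls B (~` C)%classic.
  apply: O_ls_setC => [b c bc qb|z qz]; first exact: le_trans bc.
  by apply: le_limsup => k b zb; exact: le_trans (qz k) (zb k (leqnn k)).
have /cofinite_natP[N xN] := xa _ OC (fun qa' => absurd a qa' qa).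
(* From [N] on, [q] is not below [x n], hence by decision below its complement; so [limsup x] is
   below the complement of [q]. *)
apply: (absurd _ qx); rewrite lexC; apply: (@limsup_le N) => n Nn.
by rewrite lexC; have := fq n; case: ifP => // _ /(xN n Nn).
Qed.

Lemma distributive_lim_li :
  omega_two_distributive B -> lim_of (O_li B) = lambda_li B.
Proof.
move=> dB; apply/funext => x; apply/seteqP; split; last exact: conv_le_lim.
by move=> a /lim_li_compl; rewrite distributive_lim_ls// => /lambda_li_compl.
Qed.

Lemma distributive_lim_lsi :
  omega_two_distributive B -> lim_of (O_lsi B) = lambda_s B.
Proof.
move=> dB; apply/funext => x; apply/predeqP => a.
apply: iff_trans (lim_lsiP x a) _.
rewrite distributive_lim_ls// distributive_lim_li//.
by have [? ?] := lambda_sE x a.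
Qed.

(** * Comparison of the convergences *)

(** The other inclusion comes from [O_s] being finer. It is applied with [l] the star of [lambda_s]
    under (hbar), and [lambda_s] itself under distributivity. *)
Lemma lim_lsi_squeeze (l : convergence B) :
  conv_le (lim_of (O_lsi B)) l -> conv_le l (lim_of (O_s B)) ->
  lim_of (O_lsi B) = lim_of (O_s B).
Proof.
move=> sil ls; apply/funext => x; apply/seteqP; split=> [a /sil/ls//|].
exact: lim_of_anti O_lsi_sub x.
Qed.

Lemma lambda_neq : (\bot : B) <> \top ->
  [/\ lambda_s B <> lambda_ls B, lambda_s B <> lambda_li B
    & lambda_ls B <> lambda_li B].
Proof.
move=> ne.
(* Constant sequences separate the three: the constant [\bot] at the point [\top], and the constant
   [\top] at the point [\bot]. *)
have s0 : ~ lambda_s B (fun=> \bot) \top by case=> _; rewrite limsup_cst.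
have ls0 : lambda_ls B (fun=> \bot) \top by exact: lex1.
have s1 : ~ lambda_s B (fun=> \top) \bot.
  by case=> _; rewrite limsup_cst => /esym.
have li1 : lambda_li B (fun=> \top) \bot by exact: le0x.
have ls1 : ~ lambda_ls B (fun=> \top) \bot.
  by rewrite /lambda_ls /= limsup_cst lex0 => /eqP/esym.
by split=> e; [apply: s0; rewrite e|apply: s1; rewrite e|apply: ls1; rewrite e].
Qed.

End LimsupLiminf.

Theorem theorem3p2 (d : Order.disp_t) (B : ctbDistrLatticeType d)
    (cB : complete B) :
  [/\ hbar_condition B -> lim_of (O_lsi B) = lim_of (O_s B),
      omega_two_distributive B ->
        [/\ [/\ lim_of (O_ls B) = lambda_ls B,
                lim_of (O_li B) = lambda_li B,
                lim_of (O_lsi B) = lim_of (O_s B)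
              & lim_of (O_s B) = lambda_s B],
            [/\ lambda_s B = conv_star (lambda_s B),
                conv_star (lambda_s B) = lim_of (O_s B)
              & lim_of (O_s B) = lim_of (O_lsi B)],
            lambda_ls B = conv_star (lambda_ls B) /\
              conv_star (lambda_ls B) = lim_of (O_ls B),
            lambda_li B = conv_star (lambda_li B) /\
              conv_star (lambda_li B) = lim_of (O_li B)
          & (\bot : B)%O <> (\top : B)%O ->
              [/\ lambda_s B <> lambda_ls B,
                  lambda_s B <> lambda_li B
                & lambda_ls B <> lambda_li B]]
    & lim_of (O_lsi B) = lim_of (O_s B) ->
        (O_lsi B = O_s B <-> sequential_space (O_lsi B))].
Proof.
split=> [hbar|dB|l12].
- apply: (lim_lsi_squeeze cB (hbar_lim_lsi cB hbar)).
  exact: conv_star_le_lim.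
- have lsE := distributive_lim_ls cB dB.
  have liE := distributive_lim_li cB dB.
  have lsiE := distributive_lim_lsi cB dB.
  have siE : lim_of (O_lsi B) = lim_of (O_s B).
    apply: (lim_lsi_squeeze cB (l := lambda_s B)); last exact: conv_le_lim.
    by rewrite lsiE => x.
  have sE : lim_of (O_s B) = lambda_s B by rewrite -siE.
  have sS := conv_star_eq (hereditary_s cB) sE.
  have lsS := conv_star_eq (hereditary_ls cB) lsE.
  have liS := conv_star_eq (hereditary_li cB) liE.
  rewrite siE sE lsE liE sS lsS liS; split=> //.
  exact: lambda_neq.
- apply: (sequential_eq (O_lsi_sub cB) l12).
  exact: (sequential_topology_of (hereditary_s cB)).
Qed.
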